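(* Every three-valued Łukasiewicz algebra $A$ can be represented as an algebra of rough subsets of an approximation space $(Ob, R_{Ob})$. Here $Ob$ is the set of all prime filters of $A$, and $R_{Ob}$ is the equivalence relation on $Ob$ given by: $P\, R_{Ob}\, Q$ if and only if $P$ and $Q$ are comparable, i.e. $P \subseteq Q$ or $Q \subseteq P$. ''Represented'' means that $A$ is isomorphic, as a three-valued Łukasiewicz algebra, to a subalgebra of the algebra of all rough sets of $(Ob, R_{Ob})$.
   Context: A De Morgan algebra $(A, \wedge, \vee, \sim, 1)$ is a distributive lattice $(A, \wedge, \vee)$ with greatest element $1$ and a unary operation $\sim$ satisfying $\sim\sim x = x$ and $\sim(x \wedge y) = \sim x\ \vee \sim y$; its least element is $0 = \sim 1$. A three-valued Łukasiewicz algebra is an algebra $(A, \wedge, \vee, \sim, \bigtriangledown, 1)$ of type $(2,2,1,1,0)$ such that $(A, \wedge, \vee, \sim, 1)$ is a De Morgan algebra and, for all $x, y \in A$: $\sim x \vee \bigtriangledown x = 1$; $x\, \wedge \sim x = \ \sim x \wedge \bigtriangledown x$; $\bigtriangledown(x \wedge y) = \bigtriangledown x \wedge \bigtriangledown y$. Homomorphisms, isomorphisms and subalgebras are with respect to the operations $\wedge, \vee, \sim, \bigtriangledown, 1$. Prime filters are proper. It is known that the set of prime filters of a three-valued Łukasiewicz algebra, ordered by inclusion, is a disjoint union of chains of one or two elements (elements of different chains being incomparable), so that the comparability relation $R_{Ob}$ is an equivalence relation. Throughout, the set of objects $Ob$ is assumed to be nonempty. An approximation space is a pair $(Ob, R)$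 where $Ob$ is a nonempty set and $R$ is an equivalence relation on $Ob$; $R^{\ast}$ is the set of its equivalence classes. For $X \subseteq Ob$ write $\neg X = Ob \setminus X$ and $$MX = \bigcup \{C \in R^{\ast} : C \cap X \neq \emptyset\}, \qquad LX = \neg M \neg X = \bigcup \{C \in R^{\ast} : C \subseteq X\}.$$ A rough set (rough subset) of $(Ob,R)$ is a pair $(LX, MX)$ with $X \subseteq Ob$. The collection $\{(LX,MX) : X \subseteq Ob\}$ of all rough sets is a three-valued Łukasiewicz algebra under the operations $$(LX, MX) \wedge (LY, MY) = (LX \cap LY,\ MX \cap MY),$$ $$(LX, MX) \vee (LY, MY) = (LX \cup LY,\ MX \cup MY),$$ $$\sim (LX, MX) = (L \neg X,\ M \neg X), \qquad \bigtriangledown (LX, MX) = (MX, MX),$$ $$0 = (\emptyset, \emptyset), \qquad 1 = (Ob, Ob).$$ An algebra of rough subsets of $(Ob,R)$ means a subalgebra of this algebra. *)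

(* Defs.v *)
From HB Require Import structures.
From Stdlib Require Import RelationClasses.
From mathcomp Require Import all_boot all_order.
From mathcomp Require Import boolp classical_sets functions.

Set Implicit Arguments.
Unset Strict Implicit.
Unset Printing Implicit Defensive.

Import Order.TTheory.

Local Open Scope classical_set_scope.
Local Open Scope order_scope.

(* The least element is [dm_neg \top]. The choice structure carried by MathComp
   lattices is no restriction here: classically every type has one
   ([gen_choiceMixin]). *)
HB.mixin Record isDeMorgan d T of Order.TDistrLattice d T := {
  dm_neg : T -> T;
  dm_negK : involutive dm_neg;
  dm_negI : forall x y : T, dm_neg (x `&` y) = dm_neg x `|` dm_neg y
}.

#[short(type="deMorganType")]
HB.structure Definition DeMorgan d :=
  { T of isDeMorgan d T & Order.TDistrLattice d T }.

HB.mixin Record isLukasiewicz3 d T of DeMorgan d T := {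
  nabla : T -> T;
  negUnabla : forall x : T, dm_neg x `|` nabla x = \top;
  negInabla : forall x : T, x `&` dm_neg x = dm_neg x `&` nabla x;
  nablaI : forall x y : T, nabla (x `&` y) = nabla x `&` nabla y
}.

#[short(type="lukasiewicz3Type")]
HB.structure Definition Lukasiewicz3 d :=
  { T of isLukasiewicz3 d T & DeMorgan d T }.

Record luk3_morphism d d' (A : lukasiewicz3Type d) (B : lukasiewicz3Type d')
    (f : A -> B) : Prop := Luk3Morphism {
  luk3_morphI : forall x y, f (x `&` y) = f x `&` f y;
  luk3_morphU : forall x y, f (x `|` y) = f x `|` f y;
  luk3_morph_neg : forall x, f (dm_neg x) = dm_neg (f x);
  luk3_morph_nabla : forall x, f (nabla x) = nabla (f x);
  luk3_morph1 : f \top = \top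
}.

Record luk3_subalgebra d (B : lukasiewicz3Type d) (S : set B) : Prop :=
  Luk3Subalgebra {
  luk3_subI : forall x y, S x -> S y -> S (x `&` y);
  luk3_subU : forall x y, S x -> S y -> S (x `|` y);
  luk3_sub_neg : forall x, S x -> S (dm_neg x);
  luk3_sub_nabla : forall x, S x -> S (nabla x);
  luk3_sub1 : S \top
}.

(* Meant for [S] a subalgebra of [B], whose operations are those of [B]: [f] is
   an isomorphism from [A] onto [S]. *)
Definition luk3_isomorphic_to_sub d d' (A : lukasiewicz3Type d)
    (B : lukasiewicz3Type d') (S : set B) : Prop :=
  exists f : A -> B, luk3_morphism f /\ set_bij [set: A] S f.

Record prime_filter d (A : lukasiewicz3Type d) (P : set A) : Prop :=
  PrimeFilter {
  pf_nonempty : P !=set0;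
  pf_up : forall x y, x <= y -> P x -> P y;
  pf_meet : forall x y, P x -> P y -> P (x `&` y);
  pf_proper : P <> [set: A];
  pf_prime : forall x y, P (x `|` y) -> P x \/ P y
}.

Definition primeFilter d (A : lukasiewicz3Type d) : Type :=
  {P : set A | prime_filter P}.

Definition comparable_filters d (A : lukasiewicz3Type d) (P Q : primeFilter A)
  : Prop := (sval P `<=` sval Q)%classic \/ (sval Q `<=` sval P)%classic.

Section Lukasiewicz3Theory.
Context d (A : lukasiewicz3Type d).
Implicit Types (x y : A) (P Q : primeFilter A).

Lemma dm_negU x y : dm_neg (x `|` y) = dm_neg x `&` dm_neg y.
Proof. by rewrite -[RHS]dm_negK dm_negI !dm_negK. Qed.

Lemma dm_neg_anti x y : x <= y -> dm_neg y <= dm_neg x.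
Proof. by move=> /meet_idPl <-; rewrite dm_negI leUr. Qed.

Lemma dm_bot_le x : dm_neg \top <= x.
Proof. by rewrite -(dm_negK x); apply: dm_neg_anti; rewrite lex1. Qed.

Lemma nabla_meet_join x : nabla x `&` (x `|` dm_neg x) = x.
Proof.
by rewrite meetUr [_ `&` dm_neg x]meetC -negInabla [_ `&` x]meetC -meetUr
  joinC negUnabla meetx1.
Qed.

Lemma le_nabla x : x <= nabla x.
Proof. by rewrite -{1}(nabla_meet_join x) leIl. Qed.

Lemma nabla_mono x y : x <= y -> nabla x <= nabla y.
Proof. by move=> /meet_idPl <-; rewrite nablaI leIr. Qed.

Lemma meet_neg_nabla x : x `&` dm_neg (nabla x) = dm_neg \top.
Proof. by rewrite -(negUnabla x) dm_negU dm_negK. Qed.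

Lemma nabla_bot : nabla (dm_neg \top : A) = dm_neg \top.
Proof.
by have := negInabla (dm_neg \top : A); rewrite dm_negK meetx1 meet1x.
Qed.

Lemma nabla_meet_neg x : nabla x `&` dm_neg (nabla x) = dm_neg \top.
Proof.
apply: le_anti; rewrite dm_bot_le andbT -nabla_bot -(meet_neg_nabla x) nablaI.
by rewrite leI2 // le_nabla.
Qed.

Lemma nabla_join_neg x : nabla x `|` dm_neg (nabla x) = \top.
Proof.
by rewrite -[LHS]dm_negK dm_negU dm_negK meetC nabla_meet_neg dm_negK.
Qed.

Lemma pf_top P : sval P \top.
Proof.
case: P => P HP /=; have [x Px] := pf_nonempty HP.
exact: (pf_up HP (lex1 x) Px).
Qed.

Lemma pf_bot P : ~ sval P (dm_neg \top).
Proof.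
case: P => P HP /= P0; apply: (pf_proper HP); apply/seteqP; split=> // x _.
exact: (pf_up HP (dm_bot_le x) P0).
Qed.

Lemma pf_nabla_sub P Q x : (sval P `<=` sval Q)%classic ->
  sval P (nabla x) <-> sval Q (nabla x).
Proof.
move=> PQ; split=> [/PQ //|Qx].
have := pf_top P; rewrite -(nabla_join_neg x).
case/(pf_prime (svalP P)) => // /PQ Qnx; case: (@pf_bot Q).
by rewrite -(nabla_meet_neg x); apply: (pf_meet (svalP Q)).
Qed.

Lemma comparable_filtersP P Q : comparable_filters P Q <->
  (forall x, sval P (nabla x) <-> sval Q (nabla x)).
Proof.
split=> [[PQ|QP] x|H].
- exact: pf_nabla_sub.
- by rewrite (pf_nabla_sub x QP).
apply: contrapT => /not_orP[] /existsNP[a /not_implyP[Pa nQa]].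
move=> /existsNP[b /not_implyP[Qb nPb]].
have up (R : primeFilter A) := pf_up (svalP R).
have me (R : primeFilter A) := pf_meet (svalP R).
have pr (R : primeFilter A) := pf_prime (svalP R).
have Pna : sval P (nabla a) by exact: up (le_nabla _) Pa.
have Qnb : sval Q (nabla b) by exact: up (le_nabla _) Qb.
have Pnb : sval P (nabla b) by apply/H.
have Qna : sval Q (nabla a) by apply/H.
have neg_out (R : primeFilter A) z :
    sval R (nabla z) -> ~ sval R z -> ~ sval R (dm_neg z).
  move=> Rnz nRz Rz; apply: nRz; rewrite -(nabla_meet_join z).
  by apply: me => //; apply: up Rz; rewrite leUr.
have nabla_neg (R R' : primeFilter A) z :
    (forall x, sval R (nabla x) <-> sval R' (nabla x)) ->
    ~ sval R z -> sval R' (nabla (dm_neg z)).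
  move=> RR' nRz; apply/RR'; have := pf_top R; rewrite -(negUnabla (dm_neg z)).
  by rewrite dm_negK => /pr[].
have H' x : sval Q (nabla x) <-> sval P (nabla x) by rewrite H.
have Pnna := nabla_neg _ _ _ H' nQa.
have Pnnb : sval P (nabla (dm_neg b)) by apply/H'; exact: nabla_neg H nPb.
have Pa' : sval P (dm_neg a).
  apply: contrapT => nPna; have := neg_out P (dm_neg a) Pnna nPna.
  by rewrite dm_negK.
set w := (a `&` dm_neg a) `&` (b `&` dm_neg b).
have nPw : ~ sval P w.
  move=> Pw; apply: nPb; apply: up Pw.
  by rewrite (le_trans (leIr _ _)) // leIl.
have Pnw : sval P (nabla w).
  by rewrite !nablaI; apply: (me P); apply: (me P).
apply: (neg_out P w Pnw nPw); rewrite dm_negI dm_negI.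
by apply: up Pa'; apply: le_trans (leUl _ _) (leUl _ _).
Qed.

Lemma comparable_filters_equiv : Equivalence (@comparable_filters d A).
Proof.
split=> [P|P Q|P Q S].
- by left.
- by case; [right|left].
rewrite !comparable_filtersP => PQ QS x; by rewrite PQ.
Qed.

End Lukasiewicz3Theory.

Record approxSpace := ApproxSpace {
  ob :> Type;
  ind : ob -> ob -> Prop;
  ind_equiv : Equivalence ind;
  ob_nonempty : [set: ob] !=set0
}.

Section RoughSets.
Local Open Scope classical_set_scope.
Context (O : approxSpace).
Implicit Types (X Y S : set O) (C : set O) (x y : O).

Definition ind_class x : set O := [set y | ind x y].

Definition ind_classes : set (set O) := range ind_class.

Definition upper X : set O :=
  \bigcup_(C in [set C | ind_classes C /\ C `&` X !=set0]) C.

Definition lower X : set O := ~` upper (~` X).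

Definition rough_pair (p : set O * set O) : Prop :=
  exists X, p = (lower X, upper X).

Lemma upperP X x : upper X x <-> exists2 y, ind x y & X y.
Proof.
have [r s t] := ind_equiv O; split.
- move=> [C /= [[z _ <-] [y [zy Xy]]] zx]; exists y => //.
  by apply: t zy; apply: s.
- move=> [y xy Xy]; exists (ind_class x); last exact: r.
  by split; [exists x|exists y].
Qed.

Lemma lowerP X x : lower X x <-> forall y, ind x y -> X y.
Proof.
rewrite /lower /setC /=; split.
- by move=> H y xy; apply: contrapT => nXy; apply: H; apply/upperP; exists y.
- by move=> H /upperP[y xy]; apply; exact: H.
Qed.

Lemma lowerE X : lower X =
  \bigcup_(C in [set C | ind_classes C /\ (C `<=` X)%classic]) C.
Proof.
have [r s t] := ind_equiv O; apply/seteqP; split=> x.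
- move=> /lowerP H; exists (ind_class x); last exact: r.
  by split; [exists x|].
- move=> [C /= [[z _ <-] zX] zx]; apply/lowerP => y xy; apply: zX.
  exact: t zx xy.
Qed.

Definition saturated S := forall x y, ind x y -> S x -> S y.

Lemma rough_pairP (p : set O * set O) : rough_pair p <->
  [/\ saturated p.1, saturated p.2, (p.1 `<=` p.2)%classic
    & forall x, (forall y, ind x y -> x = y) -> p.2 x -> p.1 x].
Proof.
have [r s t] := ind_equiv O; split.
- move=> [X ->] /=; split.
  + move=> x y xy /lowerP H; apply/lowerP => z yz; apply: H; exact: t xy yz.
  + move=> x y xy /upperP[z xz Xz]; apply/upperP; exists z => //.
    by apply: t xz; apply: s.
  + by move=> x /lowerP H; apply/upperP; exists x; [exact: r|apply: H; exact: r].
  + move=> x x1 /upperP[y /[dup] xy /x1 <- Xx]; apply/lowerP => z /x1 <- //.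
case: p => l u /= [satl satu lu lu1].
have [c cP] : {c : set O -> O & forall C, C !=set0 -> C (c C)}.
  apply: (@choice _ _ (fun (C : set O) z => C !=set0 -> C z)) => C.
  have [[z Cz]|nC] := pselect (C !=set0); first by exists z.
  by have [z _] := ob_nonempty O; exists z => /nC.
pose c' x := c (ind_class x).
have xc x : ind x (c' x) by apply: (cP (ind_class x)); exists x; exact: r.
have cE x y : ind x y -> c' x = c' y.
  move=> xy; rewrite /c'; congr c; apply/seteqP; split=> z /=; last exact: t.
  by move=> xz; apply: t xz; apply: s.
exists (l `|` [set x | u x /\ x = c' x]).
congr pair; apply/seteqP; split=> x.
- by move=> lx; apply/lowerP => y xy; left; exact: satl lx.
- move=> /lowerP H; apply: contrapT => nlx.
  have Hc y : ind x y -> u y /\ y = c' y.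
    move=> xy; case: (H _ xy) => // ly; case: nlx.
    by apply: satl ly; apply: s.
  apply: nlx; apply: lu1; last by have [] := Hc x (r x).
  move=> y xy; rewrite (Hc x (r x)).2 (Hc y xy).2; exact: cE.
- move=> ux; apply/upperP; exists (c' x); first exact: xc.
  by right; split; [exact: satu ux|exact: cE].
- move=> /upperP[y xy [/lu uy|[uy _]]]; exact: satu (s _ _ xy) uy.
Qed.

Definition roughSet : Type := {p : set O * set O | rough_pair p}.

Definition rough_of X : roughSet :=
  exist rough_pair (lower X, upper X) (ex_intro _ X erefl).

Lemma roughSet_inj (a b : roughSet) : sval a = sval b -> a = b.
Proof.
case: a b => [p pr] [q qr] /= e; rewrite {}e in pr *.
by congr exist; exact: Prop_irrelevance.
Qed.

Lemma rough_meet_subproof (a b : roughSet) :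
  rough_pair ((sval a).1 `&` (sval b).1, (sval a).2 `&` (sval b).2).
Proof.
have /rough_pairP[sl su lu lu1] := svalP a.
have /rough_pairP[sl' su' lu' lu1'] := svalP b.
apply/rough_pairP; split=> /= [x y xy|x y xy|x|x x1].
- by case=> /(sl _ _ xy) ? /(sl' _ _ xy).
- by case=> /(su _ _ xy) ? /(su' _ _ xy).
- by case=> /lu ? /lu'.
- by case=> /(lu1 _ x1) ? /(lu1' _ x1).
Qed.

Lemma rough_join_subproof (a b : roughSet) :
  rough_pair ((sval a).1 `|` (sval b).1, (sval a).2 `|` (sval b).2).
Proof.
have /rough_pairP[sl su lu lu1] := svalP a.
have /rough_pairP[sl' su' lu' lu1'] := svalP b.
apply/rough_pairP; split=> /= [x y xy|x y xy|x|x x1].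
- by case=> [/(sl _ _ xy)|/(sl' _ _ xy)]; [left|right].
- by case=> [/(su _ _ xy)|/(su' _ _ xy)]; [left|right].
- by case=> [/lu|/lu']; [left|right].
- by case=> [/(lu1 _ x1)|/(lu1' _ x1)]; [left|right].
Qed.

Lemma lowerC X : lower (~` X) = ~` upper X.
Proof. by rewrite /lower setCK. Qed.

Lemma upperC X : upper (~` X) = ~` lower X.
Proof. by rewrite /lower setCK. Qed.

Lemma rough_neg_subproof (a : roughSet) :
  rough_pair (~` (sval a).2, ~` (sval a).1).
Proof.
by have [X ->] := svalP a; exists (~` X); rewrite lowerC upperC.
Qed.

Lemma rough_nabla_subproof (a : roughSet) :
  rough_pair ((sval a).2, (sval a).2).
Proof.
by have /rough_pairP[? ? ? ?] := svalP a; apply/rough_pairP; split.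
Qed.

Lemma rough_top_subproof : rough_pair ([set: O], [set: O]).
Proof. by apply/rough_pairP; split. Qed.

Definition rough_meet (a b : roughSet) : roughSet :=
  exist rough_pair _ (rough_meet_subproof a b).

Definition rough_join (a b : roughSet) : roughSet :=
  exist rough_pair _ (rough_join_subproof a b).

(* [~ (L X, M X) = (L (~` X), M (~` X))], see [rough_neg_of]; since
   [L (~` X) = ~` M X] and [M (~` X) = ~` L X], this depends only on the pair. *)
Definition rough_neg (a : roughSet) : roughSet :=
  exist rough_pair _ (rough_neg_subproof a).

Definition rough_nabla (a : roughSet) : roughSet :=
  exist rough_pair _ (rough_nabla_subproof a).

Definition rough_top : roughSet := exist rough_pair _ rough_top_subproof.

Lemma rough_neg_of X : rough_neg (rough_of X) = rough_of (~` X).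
Proof. by apply: roughSet_inj; rewrite /= lowerC upperC. Qed.

Lemma rough_ofP (a : roughSet) : exists X, a = rough_of X.
Proof. by case: a => p [X e]; exists X; exact: roughSet_inj. Qed.

HB.instance Definition _ := gen_eqMixin roughSet.
HB.instance Definition _ := gen_choiceMixin roughSet.

Fact rough_display : Order.disp_t. Proof. exact: (Order.Disp tt tt). Qed.

Let le (a b : roughSet) : bool := rough_meet a b == a.
Let lt (a b : roughSet) : bool := (b != a) && le a b.

Let meetC : commutative rough_meet.
Proof. by move=> a b; apply: roughSet_inj; congr pair; exact: setIC. Qed.
Let joinC : commutative rough_join.
Proof. by move=> a b; apply: roughSet_inj; congr pair; exact: setUC. Qed.
Let meetA : associative rough_meet.
Proof. by move=> a b c; apply: roughSet_inj; congr pair; exact: setIA. Qed.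
Let joinA : associative rough_join.
Proof. by move=> a b c; apply: roughSet_inj; congr pair; exact: setUA. Qed.
Let joinKI (b a : roughSet) : rough_meet a (rough_join a b) = a.
Proof.
by case: a => [[l u] ?]; apply: roughSet_inj; congr pair;
  apply: setIidl => x; left.
Qed.
Let meetKU (b a : roughSet) : rough_join a (rough_meet a b) = a.
Proof.
by case: a => [[l u] ?]; apply: roughSet_inj; congr pair;
  apply: setUidl => x [].
Qed.
Let meetUl : left_distributive rough_meet rough_join.
Proof. by move=> a b c; apply: roughSet_inj; congr pair; exact: setIUl. Qed.
Let meetxx : idempotent_op rough_meet.
Proof.
by case=> [[l u] ?]; apply: roughSet_inj; congr pair; exact: setIid.
Qed.

HB.instance Definition _ := @Order.isMeetJoinDistrLattice.Build rough_display
  roughSet le lt rough_meet rough_join (fun _ _ => erefl) (fun _ _ => erefl)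
  meetC joinC meetA joinA joinKI meetKU meetUl meetxx.

Let lex1 (a : roughSet) : (a <= rough_top)%O.
Proof.
apply/eqP; case: a => [[l u] ?]; apply: roughSet_inj; congr pair; exact: setIT.
Qed.

HB.instance Definition _ := @Order.hasTop.Build rough_display roughSet
  rough_top lex1.

Let negK : involutive rough_neg.
Proof.
by case=> [[l u] ?]; apply: roughSet_inj; congr pair; exact: setCK.
Qed.
Let negI (a b : roughSet) :
  rough_neg (a `&` b)%O = (rough_neg a `|` rough_neg b)%O.
Proof. by apply: roughSet_inj; congr pair; exact: setCI. Qed.

HB.instance Definition _ := @isDeMorgan.Build rough_display roughSet
  rough_neg negK negI.

Let negUnabla (a : roughSet) : (rough_neg a `|` rough_nabla a)%O = rough_top.
Proof.
have /rough_pairP[_ _ lu _] := svalP a; apply: roughSet_inj.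
congr pair; apply/seteqP; split=> //= x _; have [?|?] := pselect ((sval a).2 x);
  by [right|left|left => /lu].
Qed.
Let negInabla (a : roughSet) :
  (a `&` rough_neg a)%O = (rough_neg a `&` rough_nabla a)%O.
Proof.
have /rough_pairP[_ _ lu _] := svalP a; apply: roughSet_inj.
congr pair; apply/seteqP; split=> /= x [].
- by move=> /lu.
- by [].
- by move=> ux nux.
- by move=> nlx ux.
Qed.
Let nablaI (a b : roughSet) :
  rough_nabla (a `&` b)%O = (rough_nabla a `&` rough_nabla b)%O.
Proof. exact: roughSet_inj. Qed.

HB.instance Definition _ := @isLukasiewicz3.Build rough_display roughSet
  rough_nabla negUnabla negInabla nablaI.

End RoughSets.

(* [(Ob, R_Ob)]; the nonemptiness of [Ob] is a hypothesis, it fails exactly for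
   the one-element algebra. *)
Definition prime_filter_space d (A : lukasiewicz3Type d)
    (Ob_nonempty : [set: primeFilter A] !=set0) : approxSpace :=
  ApproxSpace (comparable_filters_equiv A) Ob_nonempty.

(* Main.v *)
Require Import Defs.
From mathcomp Require Import all_boot all_order.
From mathcomp Require Import boolp classical_sets.

(** An element [a] is sent to the pair formed by the sets of prime filters
    containing [delta a] and [nabla a], where [delta a = ~ nabla (~ a)].  Both
    sets are saturated because comparable prime filters contain the same
    [nabla x].  The involution [P |-> {x | ~ x \notin P}] preserves
    comparability classes; on a one-element class it fixes [P], and then
    [nabla a \in P] forces [delta a \in P], so the pair is a rough set.
    Injectivity is the prime filter theorem together with the comparability of
    [P] and its image under the involution: this gives Moisil's principle that
    [delta a] and [nabla a] determine [a]. *)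

Import Order.TTheory.

Set Implicit Arguments.
Unset Strict Implicit.
Unset Printing Implicit Defensive.

Local Open Scope order_scope.

(** * Calculus of the modal operators *)

Section Lukasiewicz3Algebra.
Context d (A : lukasiewicz3Type d).
Implicit Types (a b x y : A) (P Q : primeFilter A).

(** The necessity operator dual to [nabla]; on rough sets it sends [(L, M)] to [(L, L)]. *)
Definition delta x : A := dm_neg (nabla (dm_neg x)).

Lemma dm_negT_join x : dm_neg \top `|` x = x.
Proof. exact/join_r/dm_bot_le. Qed.

Lemma nabla_top : nabla \top = \top :> A.
Proof. by apply: le_anti; rewrite lex1 le_nabla. Qed.

(** Here [x] and [dm_neg x] join to [\top], so [nabla x] splits into a part below [x] and [dm_neg x]
    met with [nabla x], which is the bottom. *)
Lemma nabla_complemented x : x `&` dm_neg x = dm_neg \top -> nabla x = x.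
Proof.
move=> x0; apply: le_anti; rewrite le_nabla andbT.
rewrite -[X in X <= _]meetx1 -(dm_negK \top) -x0 dm_negI dm_negK meetUr.
by rewrite meetC -negInabla x0 dm_negT_join leIr.
Qed.

Lemma nabla_nabla x : nabla (nabla x) = nabla x.
Proof. exact: nabla_complemented (nabla_meet_neg x). Qed.

Lemma delta_nabla x : delta (nabla x) = nabla x.
Proof.
rewrite /delta nabla_complemented ?dm_negK //.
by rewrite meetC nabla_meet_neg.
Qed.

Lemma nablaU x y : nabla (x `|` y) = nabla x `|` nabla y.
Proof.
apply: le_anti; rewrite leUx !nabla_mono ?leUl ?leUr // !andbT.
(* The join of two complemented elements is complemented, hence fixed by [nabla]; monotonicity then
   gives the remaining inequality. *)
have <- : nabla (nabla x `|` nabla y) = nabla x `|` nabla y.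
  apply: nabla_complemented; rewrite dm_negU meetUl meetA nabla_meet_neg.
  rewrite [dm_neg (nabla x) `&` _]meetC meetA nabla_meet_neg.
  by rewrite !(meet_idPl _) ?dm_bot_le ?joinxx.
by apply: nabla_mono; rewrite leU2 // le_nabla.
Qed.

Lemma deltaI x y : delta (x `&` y) = delta x `&` delta y.
Proof. by rewrite /delta dm_negI nablaU dm_negU. Qed.

Lemma deltaU x y : delta (x `|` y) = delta x `|` delta y.
Proof. by rewrite /delta dm_negU nablaI dm_negI. Qed.

Lemma delta_neg x : delta (dm_neg x) = dm_neg (nabla x).
Proof. by rewrite /delta dm_negK. Qed.

Lemma nabla_neg x : nabla (dm_neg x) = dm_neg (delta x).
Proof. by rewrite /delta dm_negK. Qed.

Lemma delta_top : delta \top = \top.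
Proof. by rewrite /delta nabla_bot dm_negK. Qed.

Lemma delta_le x : delta x <= x.
Proof. by rewrite -[leRHS]dm_negK; apply/dm_neg_anti/le_nabla. Qed.

(** * Prime filters and their involution *)

Lemma pfI P x y : sval P (x `&` y) <-> sval P x /\ sval P y.
Proof.
split=> [Pxy|[]]; last exact: (pf_meet (svalP P)).
by split; apply: (pf_up (svalP P)) Pxy; rewrite (leIl, leIr).
Qed.

Lemma pfU P x y : sval P (x `|` y) <-> sval P x \/ sval P y.
Proof.
split; first exact: (pf_prime (svalP P)).
by case; apply: (pf_up (svalP P)); rewrite (leUl, leUr).
Qed.

Lemma pf_neg_nabla P x : sval P (dm_neg (nabla x)) <-> ~ sval P (nabla x).
Proof.
split=> [Pn Px|nP].
  by apply: (@pf_bot _ _ P); rewrite -(nabla_meet_neg x) pfI.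
by have := pf_top P; rewrite -(nabla_join_neg x) => /pfU[].
Qed.

Lemma pf_delta P x : sval P (delta x) <-> ~ sval P (nabla (dm_neg x)).
Proof. exact: pf_neg_nabla. Qed.

Lemma pf_of_nabla P x :
  sval P (nabla x) -> sval P x \/ sval P (dm_neg x) -> sval P x.
Proof. by move=> Pn /pfU Pj; rewrite -(nabla_meet_join x) pfI. Qed.

(** The De Morgan laws exchange primeness and closure under meets. *)
Lemma prime_filter_dual P : prime_filter [set x | ~ sval P (dm_neg x)]%classic.
Proof.
split=> /=.
- by exists \top; exact: pf_bot.
- by move=> x y xy Px Py; apply: Px; apply: (pf_up (svalP P)) (dm_neg_anti xy) Py.
- by move=> x y Px Py; rewrite dm_negI => /pfU[].
- move=> e; have : [set: A]%classic (dm_neg \top) by [].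
  by rewrite -e /= dm_negK; apply; exact: pf_top.
- move=> x y; rewrite dm_negU pfI => /not_andP; exact.
Qed.

Definition pf_dual P : primeFilter A := exist _ _ (prime_filter_dual P).

Lemma comparable_pf_dual P : comparable_filters P (pf_dual P).
Proof.
by apply/comparable_filtersP => x; rewrite /= pf_neg_nabla notK.
Qed.

Lemma comparable_delta P Q x : comparable_filters P Q ->
  sval P (delta x) <-> sval Q (delta x).
Proof. by move=> /comparable_filtersP PQ; rewrite !pf_delta PQ. Qed.

(** Zorn's lemma gives a maximal filter avoiding [b]; distributivity makes it prime. *)
Lemma prime_filter_separation a b : ~ a <= b ->
  exists P : primeFilter A, sval P a /\ ~ sval P b.
Proof.
move=> nab.
(* A good set may be empty: it is a union of a possibly empty chain. *)
pose good (F : set A) := [/\ forall x y, x <= y -> F x -> F y,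
  forall x y, F x -> F y -> F (x `&` y), ~ F b & forall x, F x -> F a].
have [|F [[Fup FI nFb Fa] Fmax]] := @Zorn_bigcup _ good.
  move=> C Cgood Ctot; split.
  - move=> x y xy [F CF Fx]; exists F => //.
    by have [up _ _ _] := Cgood _ CF; exact: up Fx.
  - move=> x y [F CF Fx] [G CG Gy].
    have [_ FI _ _] := Cgood _ CF; have [_ GI _ _] := Cgood _ CG.
    by case: (Ctot _ _ CF CG) => sub; [exists G|exists F] => //;
      [apply: GI => //|apply: FI => //]; exact: sub.
  - by move=> [F CF Fb]; have [_ _] := Cgood _ CF.
  - by move=> x [F CF Fx]; exists F => //; have [_ _ _] := Cgood _ CF; apply; exact: Fx.
(* Otherwise [F] is empty and the principal filter of [a] properly extends it. *)
have Faa : F a.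
  apply: contrapT => nFa; apply: (Fmax [set x | a <= x]%classic).
    by split=> [x /Fa /nFa //|/(_ a (lexx a))].
  split=> //= [x y xy ax|x y ax ay]; first exact: le_trans xy.
  by rewrite lexI ax.
(* Otherwise the filter generated by [F] and [x] would avoid [b], against maximality. *)
have ext x : ~ F x -> exists2 w, F w & w `&` x <= b.
  move=> nFx; apply: contrapT => nw.
  apply: (Fmax [set z | exists2 w, F w & (w `&` x <= z)%O]%classic).
    split=> [z Fz|sub]; first by exists z; rewrite ?leIl.
    by apply/nFx/sub; exists a; rewrite ?leIr.
  split=> //= [y z yz [w Fw wy]|y z [w Fw wy] [v Fv vz]|y _].
  - by exists w => //; exact: le_trans yz.
  - exists (w `&` v); first exact: FI.
    by rewrite lexI (le_trans _ wy) ?(le_trans _ vz) ?leI2 ?leIl ?leIr.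
  - by exists a; rewrite ?leIl.
have Fprime : prime_filter F.
  split=> //; first by exists a.
    by move=> FT; apply: nFb; rewrite FT.
  move=> x y Fxy; apply: contrapT => /not_orP[/ext[w Fw wx] /ext[v Fv vy]].
  apply: nFb; apply: Fup (FI _ _ (FI _ _ Fw Fv) Fxy).
  rewrite meetUr leUx (le_trans _ wx) ?(le_trans _ vy) //.
    by rewrite leI2 ?leIr.
  by rewrite leI2 ?leIl.
by exists (exist _ F Fprime).
Qed.

(** If [P] contains [a] but not [b], the hypotheses put [dm_neg a] in [P] and keep [dm_neg b] out.
    So [pf_dual P] contains [b] but not [a], and is incomparable with [P]. *)
Lemma le_nabla_delta a b :
    (forall P, sval P (nabla a) -> sval P (nabla b)) ->
    (forall P, sval P (delta a) -> sval P (delta b)) ->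
  a <= b.
Proof.
move=> nab dab; apply: contrapT => /prime_filter_separation[P [Pa nPb]].
have Pnb : sval P (nabla b) by apply: nab; apply: (pf_up (svalP P)) (le_nabla a) Pa.
have nPnb : ~ sval P (dm_neg b).
  by move=> Pb; apply: nPb; apply: pf_of_nabla => //; right.
have Pna : sval P (nabla (dm_neg a)).
  apply: contrapT => /pf_delta /dab Pb; apply: nPb.
  exact: (pf_up (svalP P)) (delta_le b) Pb.
have Pa' : sval P (dm_neg a).
  by apply: pf_of_nabla => //; rewrite dm_negK; right.
by case: (comparable_pf_dual P) => sub; [case: (sub _ Pa)|apply: nPb; exact: sub].
Qed.

End Lukasiewicz3Algebra.

(** * The embedding into rough sets *)

Section Representation.
Context d (A : lukasiewicz3Type d).
Context (Ob_nonempty : nonempty [set: primeFilter A]%classic).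
Local Notation Ob := (prime_filter_space Ob_nonempty).

Definition pf_containing (x : A) : set Ob :=
  [set P : primeFilter A | sval P x]%classic.

Lemma pf_containingI x y :
  pf_containing (x `&` y) = (pf_containing x `&` pf_containing y)%classic.
Proof. by apply/seteqP; split=> P /pfI. Qed.

Lemma pf_containingU x y :
  pf_containing (x `|` y) = (pf_containing x `|` pf_containing y)%classic.
Proof. by apply/seteqP; split=> P /pfU. Qed.

Lemma pf_containing_neg_nabla x :
  pf_containing (dm_neg (nabla x)) = (~` pf_containing (nabla x))%classic.
Proof. by apply/seteqP; split=> P /pf_neg_nabla. Qed.

Lemma pf_containing_top : pf_containing \top = [set: Ob]%classic.
Proof. by apply/seteqP; split=> P _ //; exact: pf_top. Qed.

Lemma pf_containing_rough (a : A) :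
  rough_pair (pf_containing (delta a), pf_containing (nabla a)).
Proof.
apply/rough_pairP; split=> /= [P Q|P Q|P|P Psingle Pa].
- by move=> /(comparable_delta a)[].
- by move=> /comparable_filtersP/(_ a)[].
- exact: (pf_up (svalP P)) (le_trans (delta_le a) (le_nabla a)).
(* A singleton class forces [P] to equal its dual. *)
have PE x : sval P x <-> ~ sval P (dm_neg x).
  by rewrite {1}(Psingle _ (comparable_pf_dual P)).
(* With both [nabla a] and [nabla (dm_neg a)] in [P], either of [a] and [dm_neg a] brings in the
   other, whereas [PE] puts exactly one of them in [P]. *)
apply/pf_delta => Pna.
have [Pa'|nPa] := pselect (sval P a).
  by apply: ((PE a).1 Pa'); apply: pf_of_nabla => //; rewrite dm_negK; right.
apply: (nPa); apply: pf_of_nabla => //; right.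
by apply: contrapT => /(PE a).2.
Qed.

Definition rough_repr (a : A) : roughSet Ob :=
  exist _ _ (pf_containing_rough a).

Lemma rough_repr_morphism : luk3_morphism rough_repr.
Proof.
split=> [x y|x y|x|x|]; apply: roughSet_inj; congr pair => /=.
- by rewrite deltaI pf_containingI.
- by rewrite nablaI pf_containingI.
- by rewrite deltaU pf_containingU.
- by rewrite nablaU pf_containingU.
- by rewrite delta_neg pf_containing_neg_nabla.
- by rewrite nabla_neg /delta !pf_containing_neg_nabla setCK dm_negK.
- by rewrite delta_nabla.
- by rewrite nabla_nabla.
- by rewrite delta_top pf_containing_top.
- by rewrite nabla_top pf_containing_top.
Qed.

Lemma rough_repr_inj : injective rough_repr.
Proof.
move=> a b /(congr1 sval) [dE nE].
have dP P : sval P (delta a) = sval P (delta b) := congr1 (@^~ P) dE.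
have nP P : sval P (nabla a) = sval P (nabla b) := congr1 (@^~ P) nE.
by apply: le_anti; rewrite !le_nabla_delta // => P; rewrite ?dP ?nP.
Qed.

End Representation.

Lemma luk3_subalgebra_range d d' (A : lukasiewicz3Type d)
    (B : lukasiewicz3Type d') (f : A -> B) :
  luk3_morphism f -> luk3_subalgebra (range f).
Proof.
move=> [fI fU fN fn f1]; split.
- by move=> _ _ [x _ <-] [y _ <-]; exists (x `&` y).
- by move=> _ _ [x _ <-] [y _ <-]; exists (x `|` y).
- by move=> _ [x _ <-]; exists (dm_neg x).
- by move=> _ [x _ <-]; exists (nabla x).
- by exists \top.
Qed.

Theorem theorem3p2 (d : Order.disp_t) (A : lukasiewicz3Type d)
    (Ob_nonempty : nonempty [set: primeFilter A]%classic) :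
  exists S : set (roughSet (prime_filter_space Ob_nonempty)),
    luk3_subalgebra S /\ luk3_isomorphic_to_sub A S.
Proof.
exists (range (rough_repr Ob_nonempty)); split.
  exact/luk3_subalgebra_range/rough_repr_morphism.
exists (rough_repr Ob_nonempty); split; first exact: rough_repr_morphism.
split=> [x _|x y _ _|//]; [by exists x|exact: rough_repr_inj].
Qed.
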